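(* Let $m\ge3$. Let $(b_n)_{n\ge1}$, $(c_n)_{n\ge0}$ be real sequences with $c_n\neq0$ and $b_n\neq0$ for all $n$, and let $(A_n)_{n\ge0}$, $(B_n)_{n\ge0}$ be two linearly independent rational-valued solutions of $$c_ny_{n+1}+c_{n-1}y_{n-1}-b_ny_n=0,\qquad n\ge1,$$ with $A_n>0$, $B_n>0$ for all $n$, such that $\lim_{n\to\infty}B_n/A_n=L$, where $L$ is not algebraic of degree less than or equal to $m-1$ over $\mathbb{Q}$. Assume the Casoratian $W_n$ defined in the context is nonzero for all $n\ge1$. Then $L$ is algebraic of degree $m$ over $\mathbb{Q}$ if and only if the $(m+2)$-term linear recurrence relation $\mathcal{R}_m$ (defined in the context) has a non-trivial rational-valued solution $(S_n)$ such that $$\frac{S_n}{A_{n+m-2}\cdots A_{n+1}A_nA_{n-1}}\to0\quad(n\to\infty).$$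
   Context: For $n\ge1$ let $I_n=\{n-1,n,\dots,n+m-2\}$ (a set of $m$ indices), and for $k\in\{0,1,\dots,m\}$ define $$x_{k+1}^{(n-1)}=\sum_{T\subseteq I_n,\ |T|=k}\ \prod_{j\in T}B_j\prod_{j\in I_n\setminus T}A_j,$$ a sum of $\binom{m}{k}$ terms (so $x_1^{(n-1)}=A_{n+m-2}\cdots A_{n-1}$ and $x_{m+1}^{(n-1)}=B_{n+m-2}\cdots B_{n-1}$). Let $W_n=\det\big[x_j^{(n-1+i)}\big]_{0\le i\le m,\,1\le j\le m+1}$. The $(m+2)$-term linear recurrence relation $\mathcal{R}_m$ is the relation on real sequences $(z_j)_{j\ge0}$ given, for every $n\ge1$, by the vanishing of the determinant of the $(m+2)\times(m+2)$ matrix whose row $i$ ($i=0,1,\dots,m+1$) is $\big(z_{n-1+i},\,x_1^{(n-1+i)},\,x_2^{(n-1+i)},\dots,x_{m+1}^{(n-1+i)}\big)$.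
   Formalization: The solution is taken as S_n = z_{n-1} for n ≥ 1, so S_n lies in the same row as x_1^{(n-1)} = A_{n+m-2}…A_{n-1}; with S_n = z_n the claim fails, e.g. A_n = 1/n!, L transcendental, z_n = x_1^{(n)}. *)

(* Defs.v *)
From HB Require Import structures.
From mathcomp Require Import all_boot all_order all_algebra.
From mathcomp Require Import all_classical all_reals all_analysis.
Set Implicit Arguments.
Unset Strict Implicit.
Unset Printing Implicit Defensive.
Import Order.TTheory GRing.Theory Num.Theory.
Import numFieldNormedType.Exports.

Local Open Scope classical_set_scope.
Local Open Scope ring_scope.

Section AlgebraicDegree.
Variable R : realType.
Implicit Type x : R.

Definition is_minpoly (p : {poly rat}) x : Prop :=
  [/\ p \is monic, root (map_poly ratr p) x &
      forall q : {poly rat},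
        q != 0 -> root (map_poly ratr q) x -> (size p <= size q)%N].

(* [size p] is the degree of [p] plus one. *)
Definition algebraic_of_degree (d : nat) x : Prop :=
  exists2 p : {poly rat}, is_minpoly p x & size p = d.+1.

End AlgebraicDegree.

Section Sequences.
Variable R : realType.
Implicit Types (u v b c y z : nat -> R).

Definition rational_valued u : Prop := forall n, rational (u n).

Definition lin_independent u v : Prop :=
  forall s t : R, (forall n, s * u n + t * v n = 0) -> s = 0 /\ t = 0.

Definition solves_three_term c b y : Prop :=
  forall n, (1 <= n)%N ->
    c n * y n.+1 + c n.-1 * y n.-1 - b n * y n = 0.

End Sequences.

Section HigherOrderRecurrence.
Variables (R : realType) (m : nat) (A B : nat -> R).

(* [xseq k N] is x_{k+1}^{(N)}, for 0 <= k <= m: the index set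
   {N, ..., N + m - 1} is represented by 'I_m through j |-> N + j. *)
Definition xseq (k N : nat) : R :=
  \sum_(T : {set 'I_m} | #|T| == k)
    (\prod_(j in T) B (N + j)%N) * (\prod_(j in ~: T) A (N + j)%N).

(* W_n, for n >= 1 *)
Definition casoratian (n : nat) : R :=
  \det (\matrix_(i < m.+1, k < m.+1) xseq k (n.-1 + i)).

(* Row i is (z_{n-1+i}, x_1^{(n-1+i)}, ..., x_{m+1}^{(n-1+i)}). *)
Definition recurrence_mx (z : nat -> R) (n : nat) : 'M[R]_(1 + m.+1) :=
  row_mx (\col_(i < 1 + m.+1) z (n.-1 + i)%N)
         (\matrix_(i < 1 + m.+1, k < m.+1) xseq k (n.-1 + i)).

Definition solves_recurrence (z : nat -> R) : Prop :=
  forall n, (1 <= n)%N -> \det (recurrence_mx z n) = 0.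

(* A solution (S_n) is a sequence indexed by n >= 1, with S_n in the place of
   z_{n-1}, so that S_n and x_1^{(n-1)} = A_{n+m-2} ... A_{n-1} occupy the same
   row of the determinant.  This alignment matters for the limit condition
   S_n / (A_{n+m-2} ... A_{n-1}) --> 0: if S_n stood for z_n, then
   S_n = x_1^{(n)} would satisfy it whenever A_{n+m-1} / A_{n-1} --> 0 (e.g.,
   A_n = 1/n!), for any value of lim B_n / A_n.  S 0 is not used. *)
Definition nontrivial_solution (S : nat -> R) : Prop :=
  (exists2 n, (1 <= n)%N & S n != 0) /\ solves_recurrence (fun j => S j.+1).

(* A_{n+m-2} ... A_n A_{n-1}, for n >= 1 *)
Definition Aprod (n : nat) : R := \prod_(n.-1 <= j < n.-1 + m) A j.

End HigherOrderRecurrence.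

(* Main.v *)
Require Import Defs.
From HB Require Import structures.
From mathcomp Require Import all_boot all_order all_algebra.
From mathcomp Require Import all_classical all_reals all_analysis.
Set Implicit Arguments.
Unset Strict Implicit.
Unset Printing Implicit Defensive.
Import Order.TTheory GRing.Theory Num.Theory.
Import numFieldNormedType.Exports.
Local Open Scope classical_set_scope.
Local Open Scope ring_scope.

(* Since the Casoratians do not vanish, the solutions of the recurrence are
   exactly the combinations sum_k a_k x_{k+1}, and a rational-valued solution
   has rational coefficients.  Dividing x_{k+1} by the product of the A_j turns
   it into the k-th elementary symmetric function of m consecutive quotients
   B_j / A_j, which tends to binomial(m, k) L^k.  Hence such a solution is
   negligible with respect to the product of the A_j if and only if L is a root
   of sum_k binomial(m, k) a_k X^k. *)

(** The column with entries [1] and [- a] is a nonzero kernel vector. *)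
Lemma det_row_mx_mulmx (F : fieldType) (p : nat)
    (M : 'M[F]_(1 + p, p)) (a : 'cV[F]_p) : \det (row_mx (M *m a) M) = 0.
Proof.
apply/eqP; rewrite -det_tr; apply/det0P.
exists (col_mx 1%:M (- a))^T; last first.
  by rewrite -trmx_mul mul_row_col mulmx1 mulmxN subrr trmx0.
apply/eqP => /(congr1 trmx); rewrite trmxK trmx0 => /(congr1 usubmx).
rewrite col_mxKu => /matrixP /(_ 0 0) /eqP.
by rewrite !mxE eqxx oner_eq0.
Qed.

(** Take a nonzero kernel vector with blocks [s] and [u]. The invertible top rows force
    [u = - (a *m s)], whence [s] times [z - M *m a] is zero. The scalar [s] is nonzero, as otherwise
    [u] would vanish too. *)
Lemma det_row_mx_eq0 (F : fieldType) (p : nat)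
    (z : 'cV[F]_(1 + p)) (M : 'M[F]_(1 + p, p)) (a : 'cV[F]_p) :
  \det (row_mx z M) = 0 -> \det (row' ord_max M : 'M[F]_p) != 0 ->
  row' ord_max z = row' ord_max M *m a -> z = M *m a.
Proof.
move=> /eqP; rewrite -det_tr => /det0P[v v0 vM] detM za.
have {vM} : row_mx z M *m v^T = 0.
  by apply: trmx_inj; rewrite trmx_mul trmxK vM trmx0.
have : v^T != 0 by rewrite -trmx0 (inj_eq trmx_inj).
rewrite -[v^T]vsubmxK; move: (usubmx _) (dsubmx _) => s u su0.
rewrite mul_row_col => zsMu.
have {za} u_eq : u = - (a *m s).
  have /mulKmx M'K : (row' ord_max M : 'M[F]_p) \in unitmx.
    by rewrite unitmxE unitfE.
  apply/eqP; rewrite -addr_eq0 -(inj_eq (can_inj (M'K _))) mulmx0 mulmxDr.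
  rewrite mulmxA -za addrC !row'Esub !mul_rowsub_mx -linearD/= zsMu.
  by rewrite linear0.
move: zsMu su0; rewrite u_eq mulmxN mulmxA -mulmxBl [s]mx11_scalar mul_mx_scalar.
move=> /eqP; rewrite scaler_eq0 subr_eq0 => /orP[/eqP ->|/eqP //].
by rewrite raddf0 mulmx0 oppr0 col_mx0 eqxx.
Qed.

Section SolutionSpace.
Variables (R : realType) (m : nat) (A B : nat -> R).
Hypothesis casoratian_neq0 : forall n, (1 <= n)%N -> casoratian m A B n != 0.
Implicit Types (z : nat -> R) (a : 'cV[R]_m.+1).

Lemma solves_recurrence_lincomb a :
  solves_recurrence m A B (fun j => \sum_(k < m.+1) xseq m A B k j * a k 0).
Proof.
move=> n _; rewrite /recurrence_mx.
set M := \matrix_(i < 1 + m.+1, k < m.+1) _; rewrite -[RHS](det_row_mx_mulmx M a).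
congr (\det (row_mx _ _)); apply/matrixP => i j.
by rewrite !mxE ord1; apply: eq_bigr => k _; rewrite mxE.
Qed.

Lemma casoratian_mx_unit n :
  \matrix_(i < m.+1, k < m.+1) xseq m A B k (n + i) \in unitmx.
Proof. by rewrite unitmxE unitfE; exact: (casoratian_neq0 (n := n.+1)). Qed.

(** A solution is determined by its first [m.+1] values. The induction slides a window of [m.+1]
    consecutive indices by one step. *)
Lemma solves_recurrence_extend z a : solves_recurrence m A B z ->
  (forall i : 'I_m.+1, z i = \sum_(k < m.+1) xseq m A B k i * a k 0) ->
  forall j, z j = \sum_(k < m.+1) xseq m A B k j * a k 0.
Proof.
move=> zrec za.
suff win n (i : 'I_m.+1) :
    z (n + i)%N = \sum_(k < m.+1) xseq m A B k (n + i) * a k 0.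
  by move=> j; have := win j ord0; rewrite addn0.
elim: n i => [|n IHn] i; first exact: za.
(* Only the last index of the shifted window is new; the others lie in the previous window. *)
have [im|im] := ltnP i m.
  by have := IHn (Ordinal (im : (i.+1 < m.+1)%N)); rewrite /= addSnnS.
have -> : i = ord_max by apply/val_inj/anti_leq; rewrite -ltnS ltn_ord.
pose M := \matrix_(i < 1 + m.+1, k < m.+1) xseq m A B k (n + i).
have det0 : \det (row_mx (\col_(i < 1 + m.+1) z (n + i)%N) M) = 0.
  exact: (zrec n.+1 isT).
(* The top rows of [M] form the Casoratian matrix of index [n.+1], which is invertible. *)
have topM : row' ord_max M = \matrix_(i < m.+1, k < m.+1) xseq m A B k (n + i).
  by apply/matrixP => i' k; rewrite !mxE lift_max.
have /matrixP/(_ ord_max 0) : \col_(i < 1 + m.+1) z (n + i)%N = M *m a.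
  apply: (det_row_mx_eq0 det0); rewrite topM.
    exact: (casoratian_neq0 (n := n.+1) isT).
  apply/matrixP => i' j; rewrite !mxE lift_max ord1 IHn.
  by apply: eq_bigr => k _; rewrite mxE.
rewrite !mxE (_ : (n.+1 + ord_max = n + m.+1)%N) ?addSnnS// => ->.
by apply: eq_bigr => k _; rewrite mxE.
Qed.

(** The coefficients are given by an explicit formula so that their rationality can be read off from
    that of the matrix and of [z]. *)
Lemma solves_recurrence_coef z : solves_recurrence m A B z ->
  let a := invmx (\matrix_(i < m.+1, k < m.+1) xseq m A B k i) *m
           \col_(i < m.+1) z i in
  forall j, z j = \sum_(k < m.+1) xseq m A B k j * a k 0.
Proof.
move=> zrec a; apply: solves_recurrence_extend zrec _ => i.
have /mulKVmx/(_ (\col_(i < m.+1) z i)) := casoratian_mx_unit 0.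
move=> /matrixP/(_ i 0); rewrite [RHS]mxE => <-; rewrite [LHS]mxE.
by apply: eq_bigr => k _; rewrite [X in X * _]mxE.
Qed.

Lemma lincomb_eq0 a :
  (forall j, \sum_(k < m.+1) xseq m A B k j * a k 0 = 0) -> a = 0.
Proof.
move=> a0; apply: (can_inj (mulKmx (casoratian_mx_unit 0))).
rewrite mulmx0; apply/matrixP => i j; rewrite !mxE ord1 -[RHS](a0 (0 + i)%N).
by apply: eq_bigr => k _; rewrite mxE.
Qed.

End SolutionSpace.

Lemma rational_valued_ratr (R : realType) (u : nat -> R) :
  rational_valued u -> exists q : nat -> rat, forall n, u n = ratr (q n).
Proof.
move=> ru; suff /choice[q uq] : forall n, exists q, u n = ratr q by exists q.
by move=> n; have [q _ <-] := ru n; exists q.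
Qed.

Lemma xseq_ratr (R : realType) (m : nat) (A B : nat -> R) :
  rational_valued A -> rational_valued B ->
  exists q : nat -> nat -> rat, forall k j, xseq m A B k j = ratr (q k j).
Proof.
move=> /rational_valued_ratr[qA Aq] /rational_valued_ratr[qB Bq].
exists (fun k N => \sum_(T : {set 'I_m} | #|T| == k)
  (\prod_(j in T) qB (N + j)%N) * (\prod_(j in ~: T) qA (N + j)%N)) => k N.
rewrite rmorph_sum; apply: eq_bigr => T _; rewrite rmorphM !rmorph_prod.
by congr (_ * _); apply: eq_bigr.
Qed.

Lemma cvg_xseq (R : realType) (m k : nat) (A B : nat -> R) (L : R) :
  (forall n, 0 < A n) -> (fun n => B n / A n) @ \oo --> L ->
  (fun n => xseq m A B k n / Aprod m A n.+1) @ \oo --> 'C(m, k)%:R * L ^+ k.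
Proof.
move=> A0 BAL.
have -> : (fun n => xseq m A B k n / Aprod m A n.+1) =
    (fun n => \sum_(T : {set 'I_m} | #|T| == k)
      \prod_(j in T) (B (n + j)%N / A (n + j)%N)).
  apply/funext => n; rewrite /xseq mulr_suml; apply: eq_bigr => T _.
  have -> : Aprod m A n.+1 = \prod_(j < m) A (n + j)%N.
    rewrite /Aprod/= -[X in \prod_(X <= _ < _) _]add0n big_addn addKn big_mkord.
    by apply: eq_bigr => j _; rewrite addnC.
  (* The factors [A (n + j)] with [j] outside [T] cancel; those with [j] in [T] pair with
     [B (n + j)]. *)
  rewrite [X in _ / X](bigID (mem T)) /=.
  rewrite [X in _ / (_ * X)](eq_bigl (mem (~: T)));
    last by move=> j /=; rewrite finset.in_setC.
  rewrite -mulf_div divff ?mulr1 ?prodf_div//.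
  by apply/prodf_neq0 => j _; rewrite gt_eqF.
have -> : 'C(m, k)%:R * L ^+ k =
    \sum_(T : {set 'I_m} | #|T| == k) \prod_(j in T) L.
  under eq_bigr => T /eqP Tk do rewrite prodr_const Tk.
  by rewrite sumr_const -cardsE card_draws card_ord mulr_natl.
apply: cvg_big => [x|T _]; first exact: add_continuous.
apply: cvg_big => [x|j _]; first exact: mul_continuous.
by rewrite (cvg_shiftn j (fun n => B n / A n)).
Qed.

Lemma cvg_lincomb (R : realType) (m : nat) (A B : nat -> R) (L : R)
    (a : 'cV[R]_m.+1) (S : nat -> R) :
  (forall n, 0 < A n) -> (fun n => B n / A n) @ \oo --> L ->
  (forall n, S n.+1 = \sum_(k < m.+1) xseq m A B k n * a k 0) ->
  (fun n => S n / Aprod m A n) @ \oo -->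
    \sum_(k < m.+1) 'C(m, k)%:R * a k 0 * L ^+ k.
Proof.
move=> A0 BAL Sa; rewrite -cvg_shiftS.
have -> : [sequence S n.+1 / Aprod m A n.+1]_n =
    (fun n => \sum_(k < m.+1) a k 0 * (xseq m A B k n / Aprod m A n.+1)).
  apply/funext => n; rewrite /= Sa mulr_suml.
  by apply: eq_bigr => k _; rewrite -mulrA mulrCA.
apply: cvg_big => [x|k _]; first exact: add_continuous.
rewrite -mulrA mulrCA; apply: cvgM; [exact: cvg_cst|exact: cvg_xseq].
Qed.

(** A nonzero rational polynomial of least size vanishing at [x], divided by its leading
    coefficient, is a minimal polynomial. *)
Lemma root_algebraic (R : realType) (x : R) (q : {poly rat}) :
  q != 0 -> root (map_poly ratr q) x ->
  exists2 d, (d < size q)%N & algebraic_of_degree d x.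
Proof.
move=> q0 qx; pose P n := `[< exists p : {poly rat},
  [/\ p != 0, root (map_poly ratr p) x & size p = n] >].
have exP : exists n, P n by exists (size q); apply/asboolP; exists q.
case: (ex_minnP exP) => n /asboolP[p [p0 px <-]] minp.
exists (size p).-1.
  by rewrite prednK ?size_poly_gt0//; apply: minp; apply/asboolP; exists q.
exists ((lead_coef p)^-1 *: p); last first.
  by rewrite size_scale ?invr_eq0 ?lead_coef_eq0// prednK ?size_poly_gt0.
split.
- by rewrite monicE lead_coefZ mulVf ?lead_coef_eq0.
- by rewrite map_polyZ rootZ // fmorph_eq0 invr_eq0 lead_coef_eq0.
- move=> r r0 rx; rewrite size_scale ?invr_eq0 ?lead_coef_eq0//.
  by apply: minp; apply/asboolP; exists r.
Qed.

Theorem theorem4p3 (R : realType) (m : nat) (b c A B : nat -> R) (L : R)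
    (hm : (3 <= m)%N)
    (hc : forall n, c n != 0)
    (hb : forall n, (1 <= n)%N -> b n != 0)
    (ratA : rational_valued A) (ratB : rational_valued B)
    (solA : solves_three_term c b A) (solB : solves_three_term c b B)
    (indepAB : lin_independent A B)
    (A_gt0 : forall n, 0 < A n) (B_gt0 : forall n, 0 < B n)
    (limBA : (fun n => B n / A n) @ \oo --> L)
    (hL : forall d, (d <= m.-1)%N -> ~ algebraic_of_degree d L)
    (hW : forall n, (1 <= n)%N -> casoratian m A B n != 0) :
  algebraic_of_degree m L <->
  exists S : nat -> R,
    [/\ rational_valued S, nontrivial_solution m A B S &
        (fun n => S n / Aprod m A n) @ \oo --> (0 : R)].
Proof.
have bin0 (k : 'I_m.+1) : ('C(m, k)%:R : rat) != 0.
  by rewrite pnatr_eq0 -lt0n bin_gt0 -ltnS ltn_ord.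
have [x xE] := xseq_ratr m ratA ratB.
split=> [[p [pmonic proot _] psize]|[S [ratS [[n n1 Sn0] Srec] Slim]]].
(* Dividing by the binomials makes the limit equal to the value of [p] at [L], which is 0. *)
- pose a : 'cV[R]_m.+1 := \col_(k < m.+1) ratr (p`_k / 'C(m, k)%:R).
  pose S n := \sum_(k < m.+1) xseq m A B k n.-1 * a k 0.
  exists S; split.
  + move=> n; exists (\sum_(k < m.+1) x k n.-1 * (p`_k / 'C(m, k)%:R)) => //.
    by rewrite rmorph_sum; apply: eq_bigr => k _; rewrite rmorphM mxE xE.
  + split; last exact: solves_recurrence_lincomb.
    (* If [S] vanished at all positive indices, [a] would be zero, but its last entry comes from the
       leading coefficient 1 of [p]. *)
    apply: contrapT => S0; have /matrixP/(_ ord_max 0) : a = 0.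
      apply: (lincomb_eq0 hW) => j; apply/eqP; apply: contrapT => /negP Sj0.
      by apply: S0; exists j.+1.
    rewrite !mxE; apply/eqP; rewrite fmorph_eq0 mulf_neq0 ?invr_neq0//.
    by rewrite /= -[m]/(m.+1.-1) -psize -lead_coefE (monicP pmonic) oner_neq0.
  + have := cvg_lincomb A_gt0 limBA (S := S) (a := a) (fun=> erefl).
    congr (_ --> _); rewrite -[RHS](rootP proot).
    rewrite (@horner_coef_wide _ m.+1) ?size_map_poly ?psize//.
    apply: eq_bigr => k _; rewrite mxE coef_map -[_%:R]ratr_nat -rmorphM.
    by rewrite mulrCA divff ?mulr1.
- have [s sE] := rational_valued_ratr ratS.
  (* The linear system is solved over [rat]; since [ratr] commutes with matrix inversion, its
     solution maps to the real coefficients of [S]. *)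
  pose a : 'cV[rat]_m.+1 := invmx (\matrix_(i < m.+1, k < m.+1) x k i) *m
    \col_(i < m.+1) s i.+1.
  have Sa j : S j.+1 = \sum_(k < m.+1) xseq m A B k j * map_mx ratr a k 0.
    rewrite map_mxM map_invmx (solves_recurrence_coef hW Srec).
    apply: eq_bigr => k _; congr (_ * (invmx _ *m _) _ _);
      by apply/matrixP => i l; rewrite !mxE.
  pose q : {poly rat} := \poly_(k < m.+1) ('C(m, k)%:R * a (inord k) 0).
  have q0 : q != 0.
    (* The binomials are nonzero, so [q = 0] would give [a = 0] and [S n = 0]. *)
    apply: contra_neq Sn0 => q0; rewrite -(prednK n1) Sa big1// => k _.
    rewrite mxE; suff -> : a k 0 = 0 by rewrite rmorph0 mulr0.
    have /eqP := congr1 (fun r : {poly rat} => r`_k) q0.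
    rewrite coef_poly ltn_ord inord_val coef0 mulf_eq0 (negPf (bin0 k)).
    by move=> /eqP.
  have qL : root (map_poly ratr q) L.
    (* The quotients tend both to 0 and to the value of [q] at [L]; limits are unique. *)
    apply/rootP; have := cvg_lincomb A_gt0 limBA Sa.
    move=> /cvg_unique - /(_ _ _ Slim) <-//.
    rewrite (@horner_coef_wide _ m.+1) ?size_map_poly ?size_poly//.
    apply: eq_bigr => k _; rewrite coef_map coef_poly ltn_ord inord_val.
    by rewrite /= rmorphM /= ratr_nat [X in _ = _ * X * _]mxE.
  have [d] := root_algebraic q0 qL.
  (* The size of [q] is at most [m.+1], so [d <= m], and [hL] rules out [d < m]. *)
  move=> /leq_trans/(_ (size_poly _ _)); rewrite ltnS leq_eqVlt.
  case/orP => [/eqP ->//|dm /hL]; case.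
  by rewrite -ltnS prednK// (leq_trans _ hm).
Qed.
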